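(* For every $\mathfrak{s}>0$ (and every $N$), the generalized KMP model, i.e. the Markov process on $\mathbb{R}_+^{\mathbb{T}_N}$ with generator $$L_N^{\mathrm{gKMP}}f(\eta)=\sum_{x\in\mathbb{T}_N}\int_0^1\gamma_{\mathfrak{s}}(u)\big[f(\eta^{x,x+1,u})-f(\eta)\big]du,$$ is attractive.
   Context: $\mathbb{R}_+=[0,\infty)$; for an integer $N\ge2$, $\mathbb{T}_N=\mathbb{Z}/N\mathbb{Z}\cong\{0,\dots,N-1\}$ is the discrete torus. $\gamma_{\mathfrak{s}}(u)=\frac{\Gamma(4\mathfrak{s})}{\Gamma(2\mathfrak{s})^2}u^{2\mathfrak{s}-1}(1-u)^{2\mathfrak{s}-1}$ is the density on $[0,1]$ of the Beta$(2\mathfrak{s},2\mathfrak{s})$ distribution. For $u\in[0,1]$ and $\eta\in\mathbb{R}_+^{\mathbb{T}_N}$, $\eta^{x,y,u}$ is given by $(\eta^{x,y,u})_x=u(\eta_x+\eta_y)$, $(\eta^{x,y,u})_y=(1-u)(\eta_x+\eta_y)$, and $(\eta^{x,y,u})_z=\eta_z$ for $z\neq x,y$. A function $f$ on the configuration space is monotone if $f(\eta)\le f(\xi)$ whenever $\eta_x\le\xi_x$ for all $x\in\mathbb{T}_N$. For probability measures $\mu_1,\mu_2$ on the configuration space, $\mu_1\le\mu_2$ means $E_{\mu_1}[f]\le E_{\mu_2}[f]$ for every bounded monotone $f$. A process with Markov semigroup $\{S(t):t\ge0\}$ is called attractive if for all probability measures $\mu_1\le\mu_2$ on the configuration space one has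 $S(t)\mu_1\le S(t)\mu_2$ for all $t\ge0$, where $S(t)\mu$ denotes the law at time $t$ of the process started from $\mu$. *)

(* Defs.v *)
From HB Require Import structures.
From mathcomp Require Import all_boot all_order all_algebra.
From mathcomp Require Import all_classical all_reals all_analysis.

Set Implicit Arguments.
Unset Strict Implicit.
Unset Printing Implicit Defensive.

Import Order.TTheory GRing.Theory Num.Theory.
Import numFieldNormedType.Exports.

Local Open Scope classical_set_scope.
Local Open Scope ring_scope.

(* R_+^(Z/NZ). Recall that 'Z_N is Z/NZ only when 1 < N. *)
Definition config (N : nat) (R : realType) : Type := 'Z_N -> {nonneg R}.

(* The coordinate maps generate the Borel sets of R_+^(Z/NZ). *)
Definition coordinate_sets (N : nat) (R : realType) : set (set (config N R)) :=
  \bigcup_(x in [set: 'Z_N])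
    preimage_set_system setT (fun eta : config N R => (eta x)%:num) measurable.

Definition config_display : measure_display.
Proof. by constructor. Qed.

Section config_instances.
Variables (N : nat) (R : realType).

HB.instance Definition _ := gen_eqMixin (config N R).
HB.instance Definition _ := gen_choiceMixin (config N R).
HB.instance Definition _ := isPointed.Build (config N R) (fun=> 0%:nng).
HB.instance Definition _ := @isMeasurable.Build config_display (config N R)
  <<s @coordinate_sets N R >> (@sigma_algebra0 _ _ _)
  (@sigma_algebraC _ _) (@sigma_algebra_bigcup _ _ _).

End config_instances.

(* Only u in [0, 1] is ever used; the absolute values are then superfluous and
   serve to make the result a configuration for every real u. *)
Definition exchange (N : nat) (R : realType) (x y : 'Z_N) (u : R)
    (eta : config N R) : config N R := fun z =>
  if z == x then (`|u| * ((eta x)%:num + (eta y)%:num))%:nng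
  else if z == y then (`|1 - u| * ((eta x)%:num + (eta y)%:num))%:nng
  else eta z.

Definition Gamma (R : realType) (a : R) : R :=
  \int[lebesgue_measure]_(x in `]0, +oo[) (x `^ (a - 1) * expR (- x)).

Definition beta_density (R : realType) (s u : R) : R :=
  Gamma (4 * s) / Gamma (2 * s) ^+ 2
    * u `^ (2 * s - 1) * (1 - u) `^ (2 * s - 1).

Definition gKMP_generator (N : nat) (R : realType) (s : R)
    (f : config N R -> R) (eta : config N R) : R :=
  \sum_(x : 'Z_N) \int[lebesgue_measure]_(u in `[0, 1])
    (beta_density s u * (f (exchange x (x + 1) u eta) - f eta)).

Section markov_semigroups.
Context d (T : measurableType d) (R : realType).
Implicit Types (S : R -> R.-pker T ~> T).

(* Times are real numbers; only the S t with 0 <= t are constrained. The last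
   condition is the Chapman-Kolmogorov equation S(s + t) = S(s) S(t). *)
Definition markov_semigroup S :=
  (forall eta A, measurable A -> S 0 eta A = \d_eta A) /\
  (forall s t, 0 <= s -> 0 <= t -> forall eta A, measurable A ->
    S (s + t) eta A = kcomp_noparam (S s) (S t) eta A).

(* The operator f |-> S(t) f on bounded measurable functions. *)
Definition semigroup_op S (t : R) (f : T -> R) (eta : T) : R :=
  \int[S t eta]_xi f xi.

(* L, defined on all bounded measurable functions, is the infinitesimal
   generator of S for the supremum norm. *)
Definition has_generator S (L : (T -> R) -> T -> R) :=
  forall f : T -> R, measurable_fun setT f -> bounded_fun f ->
  {uniform, (fun (t : R) eta => t^-1 * (semigroup_op S t f eta - f eta)) @ 0^'+
     --> L f}.

Section law.
Variables (k : R.-pker T ~> T) (mu : probability T R).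
Local Open Scope ereal_scope.

Definition law (A : set T) : \bar R := \int[mu]_eta k eta A.

Let law0 : law set0 = 0.
Proof. by apply: integral0_eq => x _; rewrite measure0. Qed.

Let law_ge0 A : 0 <= law A.
Proof. by apply: integral_ge0 => x _; exact: measure_ge0. Qed.

Let law_sigma_additive : semi_sigma_additive law.
Proof.
move=> F mF tF mUF; rewrite [X in _ --> X](_ : _ =
    \int[mu]_x (\sum_(0 <= n <oo) k x (F n))); last first.
  by apply: eq_integral => x _; rewrite measure_semi_bigcup.
rewrite integral_nneseries//; last first.
  by move=> n; exact: measurable_kernel.
apply: is_cvg_ereal_nneg_natsum_cond => n _ _.
exact: law_ge0.
Qed.

HB.instance Definition _ :=
  isMeasure.Build _ _ _ law law0 law_ge0 law_sigma_additive.

Let lawT : law setT = 1.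
Proof.
rewrite /law (eq_integral (cst 1)); last by move=> x _; rewrite prob_kernel.
by rewrite integral_cst//= probability_setT mule1.
Qed.

HB.instance Definition _ := Measure_isProbability.Build _ _ _ law lawT.

(* S(t) mu is law_at (S t) mu. *)
Definition law_at : probability T R := law.

End law.

End markov_semigroups.

Definition monotone (N : nat) (R : realType) (f : config N R -> R) :=
  forall eta xi : config N R,
    (forall x, (eta x)%:num <= (xi x)%:num) -> f eta <= f xi.

Definition stochastic_le (N : nat) (R : realType)
    (mu1 mu2 : probability (config N R) R) :=
  forall f : config N R -> R, measurable_fun setT f -> bounded_fun f ->
    monotone f -> ('E_mu1[f] <= 'E_mu2[f])%E.

Definition attractive (N : nat) (R : realType)
    (S : R -> R.-pker (config N R) ~> (config N R)) :=
  forall mu1 mu2 : probability (config N R) R, stochastic_le mu1 mu2 ->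
  forall t, 0 <= t -> stochastic_le (law_at (S t) mu1) (law_at (S t) mu2).

(* Main.v *)
From HB Require Import structures.
Require Import Defs.
From mathcomp Require Import all_boot all_order all_algebra.
From mathcomp Require Import all_classical all_reals all_analysis.
From mathcomp Require Import measurable_realfun ring lra.

Set Implicit Arguments.
Unset Strict Implicit.
Unset Printing Implicit Defensive.

(** The gKMP semigroup preserves monotone functions because its generator is a
positive jump operator whose jumps respect the coordinatewise order.

Write [D g] for the supremum of [g eta - g xi] over all [eta <= xi]; a function
is monotone when [D g <= 0].  For fixed [x] and [u] the map [exchange x (x + 1) u]
is monotone ([exchange_homo]).  Hence, if [c] is the total mass of the jump
rates, an Euler step [g + h L g] with [h c <= 1] is a combination with
nonnegative weights of [g] and of the functions [g \o exchange x (x + 1) u], the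
weights adding up to one: it satisfies [D (g + h L g) <= B] as soon as
[D g <= B] and [0 <= B] ([gKMP_euler_step]).  The mass [c] is finite because the
beta density is integrable ([integrable_beta_density]), being dominated by a
multiple of [u `^ (p - 1) + (1 - u) `^ (p - 1)], where [p = 2 s > 0], which has a
bounded primitive.

To pass from Euler steps to the semigroup, cut [0, t] into [n] steps of length
[h = t / n] and put [f_k = S(k h) f].  The error of one step,
[f_(k+1) - f_k - h L f_k], is at most [h e] uniformly in [k], with [e]
arbitrarily small ([generator_semigroup_op_estimate]); each step thus increases
[D] by at most [2 h e], and [D (S(t) f) <= 2 t e] for a monotone [f].  Letting
[e] tend to [0] gives [semigroup_op_homo].

Finally the expectation of [f] under [S(t) mu] is the expectation of [S(t) f]
under [mu] ([Rintegral_mixture]), and [S(t) f] is a bounded monotone test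
function when [f] is one. *)

Import Order.TTheory GRing.Theory Num.Theory.
Import numFieldNormedType.Exports.

Local Open Scope classical_set_scope.
Local Open Scope ring_scope.

(** * Bounded functions and measures of unit mass *)

Section bounded_functions.
Context d (T : measurableType d) (R : realType).
Implicit Types (f g : T -> R).

Lemma bounded_funP f : bounded_fun f <-> exists M : R, forall x, `|f x| <= M.
Proof.
split=> [[M [_ fM]]|[M fM]].
  by exists (M + 1) => x; apply: fM => //; rewrite ltrDl.
exists M; split; first exact: num_real.
by move=> K MK x _ /=; rewrite (le_trans (fM x))// ltW.
Qed.

Lemma bounded_integrable (mu : {measure set T -> \bar R}) f :
  mu setT = 1%E -> measurable_fun setT f -> bounded_fun f ->
  mu.-integrable setT (EFin \o f).
Proof.
move=> mu1 mf bf; apply: measurable_bounded_integrable => //.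
by rewrite mu1 ltry.
Qed.

Lemma Rintegral_cst1 (mu : {measure set T -> \bar R}) (r : R) :
  mu setT = 1%E -> \int[mu]__ r = r.
Proof. by move=> mu1; rewrite Rintegral_cst// mu1 mulr1. Qed.

Lemma Rintegral_dist_le (mu : {measure set T -> \bar R}) f g e :
  mu setT = 1%E -> measurable_fun setT f -> bounded_fun f ->
  measurable_fun setT g -> bounded_fun g ->
  (forall x, `|f x - g x| <= e) -> `|\int[mu]_x f x - \int[mu]_x g x| <= e.
Proof.
move=> mu1 mf bf mg bg fge.
have If := bounded_integrable mu1 mf bf; have Ig := bounded_integrable mu1 mg bg.
rewrite -RintegralB//.
have Ifg : mu.-integrable setT (EFin \o (fun x => f x - g x)).
  by have := integrableB measurableT If Ig; apply: eq_integrable.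
rewrite (le_trans (le_normr_Rintegral _ _))//.
rewrite -[leRHS](Rintegral_cst1 e mu1); apply: le_Rintegral => //.
  exact: integrable_norm.
apply: bounded_integrable => //.
by apply/bounded_funP; exists `|e|.
Qed.

(** Reduces bounded functions to nonnegative ones, by adding a bound [M]. *)
Lemma Rintegral_addr_cst (mu : {measure set T -> \bar R}) f M :
  mu setT = 1%E -> measurable_fun setT f -> bounded_fun f ->
  (\int[mu]_y (f y + M)%:E = (\int[mu]_y f y + M)%:E)%E.
Proof.
move=> mu1 mf bf.
have If := bounded_integrable mu1 mf bf.
have Ic : mu.-integrable setT (EFin \o cst M).
  apply: bounded_integrable => //.
  by apply/bounded_funP; exists `|M|.
rewrite integralD_EFin// integral_cst// mu1 mule1 EFinD fineK//.
exact: integrable_fin_num.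
Qed.

End bounded_functions.

(** * Mixtures of a probability kernel *)

Section mixture.
Context d d' (X : measurableType d) (Y : measurableType d') (R : realType).
Variables (mu : {measure set X -> \bar R}) (k : R.-pker X ~> Y).
Hypothesis mu1 : mu setT = 1%E.

(** A copy of [mu] that carries the structure of a probability. *)
Let mass_one : set X -> \bar R := let _ := mu1 in mu.

HB.instance Definition _ := Measure.on mass_one.
HB.instance Definition _ := Measure_isProbability.Build _ _ _ mass_one mu1.

(** A measure is a kernel with a constant source, so this is an instance of the
integral formula for the composition of kernels. *)
Lemma ge0_integral_mixture (nu : {measure set Y -> \bar R}) (f : Y -> \bar R) :
  (forall A, measurable A -> nu A = \int[mu]_x k x A)%E ->
  (forall y, 0 <= f y)%E -> measurable_fun setT f ->
  (\int[nu]_y f y = \int[mu]_x \int[k x]_y f y)%E.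
Proof.
move=> nuE f0 mf.
pose l := kprobability
  (@measurable_cst _ _ unit _ setT (mass_one : pprobability X R)).
rewrite (eq_measure_integral (kcomp l (kernel.kernel_snd k) tt)).
  by rewrite (@integral_kcomp _ _ _ _ _ _ _ l (kernel.kernel_snd k)).
by move=> A mA _; rewrite nuE.
Qed.

End mixture.

Section bounded_mixture.
Context d d' (X : measurableType d) (Y : measurableType d') (R : realType).
Implicit Types (k : R.-pker X ~> Y) (f : Y -> R).

Lemma measurable_kernel_Rintegral k f :
  measurable_fun setT f -> bounded_fun f ->
  measurable_fun setT (fun x => \int[k x]_y f y).
Proof.
move=> mf bf; have [M fM] := (bounded_funP f).1 bf.
rewrite (_ : (fun x => _) =
    (fun x => fine (\int[k x]_y (f y + M)%:E)%E - M)); last first.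
  by apply/funext => x; rewrite Rintegral_addr_cst ?prob_kernel//= addrK.
apply: measurable_funB => //; apply: measurableT_comp => //.
apply: measurable_fun_integral_kernel.
- by move=> U mU; exact: measurable_kernel.
- by move=> y; move: (fM y); rewrite lee_fin ler_norml => /andP[+ _]; lra.
- by apply/measurable_EFinP; exact: measurable_funD.
Qed.

Lemma bounded_kernel_Rintegral k f :
  measurable_fun setT f -> bounded_fun f ->
  bounded_fun (fun x => \int[k x]_y f y).
Proof.
move=> mf bf; have [M fM] := (bounded_funP f).1 bf.
apply/bounded_funP; exists M => x.
have k1 : k x setT = 1%E by rewrite prob_kernel.
rewrite -[\int[k x]_y f y]subr0 -[X in _ - X](Rintegral_cst1 0 k1).
apply: Rintegral_dist_le => //.
- by apply/bounded_funP; exists 0 => y; rewrite normr0.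
- by move=> y; rewrite subr0.
Qed.

(** Serves both for the Chapman-Kolmogorov equation, where [mu] and [nu] are
values of the kernels of the semigroup, and for the law at time [t].  The
nonnegative case is applied to [f + M], where [M] bounds [f]. *)
Lemma Rintegral_mixture (mu : {measure set X -> \bar R}) k
    (nu : {measure set Y -> \bar R}) f :
  mu setT = 1%E -> (forall A, measurable A -> nu A = \int[mu]_x k x A)%E ->
  measurable_fun setT f -> bounded_fun f ->
  \int[nu]_y f y = \int[mu]_x \int[k x]_y f y.
Proof.
move=> mu1 nuE mf bf; have [M fM] := (bounded_funP f).1 bf.
have nu1 : nu setT = 1%E.
  rewrite nuE// (eq_integral (cst 1%E)); last by move=> x _; rewrite prob_kernel.
  by rewrite integral_cst// mu1 mule1.
have /(congr1 fine) : (\int[nu]_y (f y + M)%:E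
    = \int[mu]_x (\int[k x]_y f y + M)%:E)%E.
  rewrite (ge0_integral_mixture mu1 nuE).
  - by apply: eq_integral => x _; rewrite Rintegral_addr_cst// prob_kernel.
  - by move=> y; move: (fM y); rewrite lee_fin ler_norml => /andP[+ _]; lra.
  - by apply/measurable_EFinP; exact: measurable_funD.
have mk := measurable_kernel_Rintegral k mf bf.
have bk := bounded_kernel_Rintegral k mf bf.
rewrite (Rintegral_addr_cst _ nu1 mf bf) (Rintegral_addr_cst _ mu1 mk bk)/=.
exact: addIr.
Qed.

End bounded_mixture.

(** * Semigroups and Euler steps *)

Section semigroup.
Context d (T : measurableType d) (R : realType).
Variables (S : R -> R.-pker T ~> T) (L : (T -> R) -> T -> R).
Hypothesis hS : markov_semigroup S.
Implicit Types (f g : T -> R) (r h t e : R).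

Lemma measurable_semigroup_op t f :
  measurable_fun setT f -> bounded_fun f -> measurable_fun setT (semigroup_op S t f).
Proof. by move=> mf bf; exact: measurable_kernel_Rintegral. Qed.

Lemma bounded_semigroup_op t f :
  measurable_fun setT f -> bounded_fun f -> bounded_fun (semigroup_op S t f).
Proof. by move=> mf bf; exact: bounded_kernel_Rintegral. Qed.

Lemma semigroup_op0 f : measurable_fun setT f -> semigroup_op S 0 f = f.
Proof.
move=> mf; apply/funext => eta; rewrite /semigroup_op /Rintegral.
rewrite (eq_measure_integral (\d_eta : {measure set T -> \bar R})).
  by rewrite integral_dirac ?diracT ?mul1e//; exact/measurable_EFinP.
by move=> A mA _; rewrite hS.1.
Qed.

Lemma semigroup_opD r t f : 0 <= r -> 0 <= t ->
  measurable_fun setT f -> bounded_fun f ->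
  semigroup_op S (r + t) f = semigroup_op S r (semigroup_op S t f).
Proof.
move=> r0 t0 mf bf; apply/funext => eta.
have k1 : S r eta setT = 1%E by rewrite prob_kernel.
exact: (@Rintegral_mixture _ _ _ _ _ (S r eta) (S t) (S (r + t) eta) f k1
  (fun A mA => hS.2 r t r0 t0 eta A mA)).
Qed.

Hypothesis hL : has_generator S L.

Lemma has_generatorP f e : measurable_fun setT f -> bounded_fun f -> 0 < e ->
  exists2 a, 0 < a & forall h, 0 < h -> h < a -> forall eta,
    `|L f eta - h^-1 * (semigroup_op S h f eta - f eta)| < e.
Proof.
move=> mf bf e0.
have /(_ [set g | forall eta, ball (L f eta) e (g eta)]) := hL mf bf.
case.
  apply/uniform_nbhs; exists [set xy | ball xy.1 e xy.2]; split.
    exact: (entourage_ball _ (PosNum e0)).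
  by move=> g /= gE eta; exact: gE.
move=> a /= a0 aP; exists a => // h h0 ha eta.
apply: (aP h) => //=.
by rewrite sub0r normrN gtr0_norm.
Qed.

(** Here [a] does not depend on [r], although the convergence of the difference
quotients to the generator is only known one function at a time.  Write [q t]
for the difference quotient of [f] at [t].  Since the [q t] converge, [q h] and
[q c] are close for all small [h] and [c], hence so are their images under the
contraction [S(r)], which are the difference quotients of [g = S(r) f].  The one
at [c] is close to [L g] once [c] is small, where the bound on [c], but not that
on [h], depends on [r]. *)
Lemma generator_semigroup_op_estimate f e :
  measurable_fun setT f -> bounded_fun f -> 0 < e ->
  exists2 a, 0 < a & forall h, 0 < h -> h < a -> forall r, 0 <= r -> forall eta,
    `|semigroup_op S (r + h) f eta
      - (semigroup_op S r f eta + h * L (semigroup_op S r f) eta)| <= h * e.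
Proof.
move=> mf bf e0.
have [a a0 fa] : exists2 a, 0 < a & forall h, 0 < h -> h < a -> forall eta,
    `|L f eta - h^-1 * (semigroup_op S h f eta - f eta)| < e / 3.
  by apply: has_generatorP => //; rewrite divr_gt0.
exists a => // h h0 ha r r0 eta.
set g := semigroup_op S r f.
have mg : measurable_fun setT g by exact: measurable_semigroup_op.
have bg : bounded_fun g by exact: bounded_semigroup_op.
have [b b0 gb] : exists2 b, 0 < b & forall h, 0 < h -> h < b -> forall eta,
    `|L g eta - h^-1 * (semigroup_op S h g eta - g eta)| < e / 3.
  by apply: has_generatorP => //; rewrite divr_gt0.
pose q t xi := t^-1 * (semigroup_op S t f xi - f xi).
have mT t : measurable_fun setT (semigroup_op S t f).
  exact: measurable_semigroup_op.
have bT t : bounded_fun (semigroup_op S t f) by exact: bounded_semigroup_op.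
have mq t : measurable_fun setT (q t).
  by apply: measurable_funM => //; exact: measurable_funB.
have mTf t : measurable_fun setT (fun xi => semigroup_op S t f xi - f xi).
  exact: measurable_funB.
have bTf t : bounded_fun (fun xi => semigroup_op S t f xi - f xi).
  have [M fM] := (bounded_funP f).1 bf; have [K TK] := (bounded_funP _).1 (bT t).
  apply/bounded_funP; exists (K + M) => xi.
  by rewrite (le_trans (ler_normB _ _))//; exact: lerD.
have bq t : bounded_fun (q t).
  have [M TfM] := (bounded_funP _).1 (bTf t).
  by apply/bounded_funP; exists (`|t^-1| * M) => xi; rewrite normrM ler_wpM2l.
have k1 : S r eta setT = 1%E by rewrite prob_kernel.
have Tq t : 0 <= t -> semigroup_op S r (q t) eta
    = t^-1 * (semigroup_op S (r + t) f eta - g eta).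
  move=> t0; have := bounded_integrable k1 (mTf t) (bTf t).
  move=> /RintegralZl ITf.
  rewrite -[LHS]/(\int[S r eta]_xi (t^-1 * (semigroup_op S t f xi - f xi))).
  rewrite ITf//.
  rewrite RintegralB//; [|exact: bounded_integrable..].
  by rewrite -!/(semigroup_op _ _ _ _) semigroup_opD.
(* Any time below [a] and [b] will do. *)
pose c := Num.min a b / 2.
have [ca cb c0] : [/\ c < a, c < b & 0 < c].
  have : Num.min a b <= a by rewrite ge_min lexx.
  have : Num.min a b <= b by rewrite ge_min lexx orbT.
  have : 0 < Num.min a b by rewrite lt_min a0 b0.
  by rewrite /c; split; lra.
have qq : `|semigroup_op S r (q h) eta - semigroup_op S r (q c) eta| <= e / 3 * 2.
  apply: Rintegral_dist_le => // xi.
  have := fa h h0 ha xi; have := fa c c0 ca xi; rewrite -/(q c xi) -/(q h xi).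
  by rewrite !ltr_norml ler_norml; lra.
have Lg := gb c c0 cb eta.
have -> : semigroup_op S (r + h) f eta - (g eta + h * L g eta)
    = h * (semigroup_op S r (q h) eta - L g eta).
  by rewrite Tq ?ltW// mulrBr mulVKf ?gt_eqF// opprD addrA.
rewrite normrM gtr0_norm// ler_pM2l//.
have Tc : semigroup_op S r (q c) eta = c^-1 * (semigroup_op S c g eta - g eta).
  by rewrite Tq ?ltW// (addrC r) semigroup_opD// ltW.
move: qq Lg; rewrite -Tc ltr_norml !ler_norml; lra.
Qed.

Variable le : T -> T -> Prop.

(** An order-theoretic maximum principle: if short Euler steps never increase a
nonnegative bound on the order defect [g eta - g xi], [le eta xi], then the
semigroup preserves monotonicity.  The bound has to range over all [B >= 0]: an Euler
step only approximates the semigroup, so the defect of [S(k h) f] is not known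
to be nonpositive at intermediate times. *)
Lemma semigroup_op_homo :
  (exists2 a, 0 < a & forall h, 0 < h -> h < a -> forall g B,
    measurable_fun setT g -> bounded_fun g -> 0 <= B ->
    (forall eta xi, le eta xi -> g eta - g xi <= B) ->
    forall eta xi, le eta xi ->
      (g eta + h * L g eta) - (g xi + h * L g xi) <= B) ->
  forall f t, measurable_fun setT f -> bounded_fun f -> 0 <= t ->
    (forall eta xi, le eta xi -> f eta <= f xi) ->
    forall eta xi, le eta xi -> semigroup_op S t f eta <= semigroup_op S t f xi.
Proof.
move=> [a a0 step] f t mf bf t0 fle eta xi exi.
move: t0; rewrite le_eqVlt => /predU1P[<-|t0].
  by rewrite semigroup_op0//; exact: fle.
apply/ler_addgt0Pr => e e0.
have [b b0 est] : exists2 b, 0 < b & forall h, 0 < h -> h < b ->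
    forall r, 0 <= r -> forall eta,
    `|semigroup_op S (r + h) f eta
      - (semigroup_op S r f eta + h * L (semigroup_op S r f) eta)|
    <= h * (e / (2 * t)).
  by apply: generator_semigroup_op_estimate => //; rewrite divr_gt0// mulr_gt0.
have m0 : 0 < Num.min a b by rewrite lt_min a0 b0.
have [n nt] : exists n, t / Num.min a b < n%:R.
  exists (Num.bound (t / Num.min a b)); apply: archi_boundP.
  by rewrite ltW// divr_gt0.
have n0 : 0 < n%:R :> R by rewrite (le_lt_trans _ nt)// ltW// divr_gt0.
pose h := t / n%:R.
have h0 : 0 < h by rewrite divr_gt0.
have [ha hb] : h < a /\ h < b.
  have : h < Num.min a b by rewrite ltr_pdivrMr// mulrC -ltr_pdivrMr.
  by rewrite lt_min => /andP.
(* Both [eta] and [xi] contribute an error of at most [h * (e / (2 * t))] to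
   each step; over [n] steps this adds up to [e]. *)
suff H k : forall eta xi, le eta xi ->
    semigroup_op S (k%:R * h) f eta - semigroup_op S (k%:R * h) f xi
    <= k%:R * (2 * (h * (e / (2 * t)))).
  have := H n eta xi exi.
  have -> : n%:R * h = t by rewrite mulrC divfK// gt_eqF.
  have -> : n%:R * (2 * (h * (e / (2 * t)))) = e.
    by rewrite /h; field; rewrite !gt_eqF.
  by rewrite lerBlDl addrC.
elim: k => [|k IHk] {exi} eta' xi' exi.
  by rewrite !mul0r semigroup_op0// subr_le0; exact: fle.
have -> : k.+1%:R * h = k%:R * h + h by rewrite -natr1; ring.
have kh0 : 0 <= k%:R * h by rewrite mulr_ge0// ltW.
have := est h h0 hb _ kh0 eta'; have := est h h0 hb _ kh0 xi'.
have := step h h0 ha (semigroup_op S (k%:R * h) f)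
  (k%:R * (2 * (h * (e / (2 * t))))).
move=> /(_ _ _ _ IHk eta' xi' exi) => /(_ _ _ _)/wrap[].
- exact: measurable_semigroup_op.
- exact: bounded_semigroup_op.
- by rewrite !mulr_ge0// ?invr_ge0 ?mulr_ge0// ltW.
rewrite -natr1 !ler_norml.
set u := h * (e / _); lra.
Qed.

End semigroup.

(** * Integrability of the beta density *)

Section beta_mass.
Context {R : realType}.
Local Notation mu := (@lebesgue_measure R).

(** The primitive bounds the integrals over the intervals [D n], which exhaust
the open interval from inside and stay away from the possible singularities of [f] at
[a] and [b]. *)
Lemma ge0_integral_oo_bounded_primitive (f F : R -> R) (a b M : R) :
  a < b -> {in `]a, b[, continuous f} -> {in `]a, b[, forall x, 0 <= f x} ->
  {in `]a, b[, forall x : R, is_derive x 1 F (f x)} ->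
  {in `]a, b[, forall x, `|F x| <= M} ->
  (\int[mu]_(x in `]a, b[) (f x)%:E <= (2 * M)%:E)%E.
Proof.
move=> ab cf f0 dF FM.
(* Dividing by [n.+3] makes every [D n] below nondegenerate. *)
pose e (n : nat) := (b - a) / n.+3%:R.
have e0 n : 0 < e n by rewrite divr_gt0// subr_gt0.
have e3 n : 3 * e n <= b - a.
  rewrite /e mulrCA ler_piMr//; first by rewrite subr_ge0 ltW.
  by rewrite ler_pdivrMr// mul1r ler_nat.
pose D n := `[a + e n, b - e n]%classic.
have Dab n x : D n x -> x \in `]a, b[.
  rewrite /D/= !in_itv/= => /andP[xa xb]; have en := e0 n.
  by apply/andP; split; lra.
have DE : `]a, b[%classic = \bigcup_n D n.
  apply/seteqP; split => x; last by move=> [n _] /Dab.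
  rewrite /= in_itv/= => /andP[ax xb].
  pose m := Num.min (x - a) (b - x).
  have m0 : 0 < m by rewrite lt_min !subr_gt0 ax xb.
  have [n nm] : exists n : nat, (b - a) / m < n%:R.
    exists (Num.bound ((b - a) / m)); apply: archi_boundP.
    by rewrite ltW// divr_gt0// subr_gt0.
  have em : e n <= m.
    rewrite ler_pdivrMr// mulrC -ler_pdivrMr// (le_trans (ltW nm))//.
    by rewrite ler_nat -addn3 leq_addr.
  exists n => //; rewrite /D/= in_itv/=.
  have /andP[] : (m <= x - a) && (m <= b - x) by rewrite -le_min.
  by move=> *; apply/andP; split; lra.
have cfD n : {within D n, continuous f}.
  by apply: continuous_in_subspaceT => x /set_mem /Dab; exact: cf.
rewrite DE.
have mD n : measurable (D n) by exact: measurable_itv.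
have ndD : nondecreasing_seq D.
  move=> m n mn; apply/subsetPset; rewrite /D => x/=; rewrite !in_itv/=.
  suff : e n <= e m by move=> ? /andP[? ?]; apply/andP; split; lra.
  by rewrite ler_pM2l ?subr_gt0// lef_pV2 ?posrE// ler_nat.
have mf n : measurable_fun (D n) (EFin \o f).
  apply/measurable_EFinP; apply: subspace_continuous_measurable_fun => //.
have cvgI : (\int[mu]_(x in D i) (f x)%:E)%E @[i --> \oo] -->
    (\int[mu]_(x in \bigcup_i D i) (f x)%:E)%E.
  apply: ge0_nondecreasing_set_cvg_integral => //.
  by move=> n x /Dab xab; rewrite lee_fin f0.
rewrite -(cvg_lim _ cvgI)//; apply: lime_le.
  by apply/cvg_ex; eexists; exact: cvgI.
near=> n.
have abn : a + e n < b - e n by have := e0 n; have := e3 n; lra.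
rewrite (@continuous_FTC2 R f F _ _ abn (cfD n)).
- rewrite -EFinB lee_fin.
  have := FM (b - e n) (Dab n _ _); have := FM (a + e n) (Dab n _ _).
  rewrite /D/= !in_itv/= !lexx (ltW abn) => /(_ isT) + /(_ isT).
  by rewrite !ler_norml; lra.
- have cF x : x \in `]a, b[ -> {for x, continuous F}.
    by move=> /dF[dFx _]; apply/differentiable_continuous/derivable1_diffP.
  split.
  + by move=> x xab; have [] := dF x (Dab n x (subset_itv_oo_cc xab)).
  + apply: cvg_at_right_filter; apply: cF; apply: (Dab n).
    by rewrite /D/= in_itv/= lexx ltW.
  + apply: cvg_at_left_filter; apply: cF; apply: (Dab n).
    by rewrite /D/= in_itv/= lexx ltW.
- move=> x xab; rewrite derive1E.
  by have [] := dF x (Dab n x (subset_itv_oo_cc xab)).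
Unshelve. all: by end_near. Qed.

Lemma integral_powR_onem_powR_lty (p : R) : 0 < p ->
  (\int[mu]_(u in `]0%R, 1%R[) (u `^ (p - 1) + (1 - u) `^ (p - 1))%:E < +oo)%E.
Proof.
move=> p0.
pose f u : R := u `^ (p - 1) + (1 - u) `^ (p - 1).
pose F u : R := p^-1 * (u `^ p - (1 - u) `^ p).
have dpow (q x : R) : x \in `]0, 1[ ->
    is_derive x 1 (fun u => (1 - u) `^ q) (- (q * (1 - x) `^ (q - 1))).
  rewrite in_itv/= => /andP[x0 x1].
  have x10 : 0 < 1 - x by rewrite subr_gt0.
  have d1 : is_derive x 1 (fun u : R => 1 - u) (- 1).
    by have := is_deriveB (is_derive_cst (1 : R) x 1) (is_derive_id x 1); rewrite sub0r.
  have := @is_derive1_comp R (fun y => y `^ q) (fun u : R => 1 - u) x _ _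
    (is_derive1_powR q x10) d1.
  by rewrite mulrN1.
have dF (x : R) : x \in `]0, 1[ -> is_derive x 1 F (f x).
  move=> x01; have d2 := dpow p x x01.
  have d1 : is_derive x 1 (fun u : R => u `^ p) (p * x `^ (p - 1)).
    by apply: is_derive1_powR; move: x01; rewrite in_itv/= => /andP[].
  have := is_deriveZ p^-1 (is_deriveB d1 d2).
  rewrite opprK -mulrDr /f /GRing.scale/= mulrA mulVf ?gt_eqF// mul1r.
  exact: id.
apply: (@le_lt_trans _ _ (2 * (2 / p))%:E); last exact: ltry.
apply: (@ge0_integral_oo_bounded_primitive f F) => //.
- move=> x x01; apply/differentiable_continuous/derivable1_diffP.
  apply: derivableD.
    by apply: derivable_powR; move: x01; rewrite !in_itv/= andbT => /andP[].
  by have [] := dpow (p - 1) x x01.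
- by move=> x _; rewrite addr_ge0// powR_ge0.
- move=> x; rewrite in_itv/= => /andP[x0 x1].
  rewrite normrM gtr0_norm ?invr_gt0// mulrC ler_pM2r ?invr_gt0//.
  have le1 y : 0 < y -> y < 1 -> 0 <= y `^ p <= 1.
    move=> y0 y1; rewrite powR_ge0/= (_ : 1 = 1 `^ p); last by rewrite powR1.
    by rewrite ge0_ler_powR ?nnegrE ?ltW.
  have := le1 x x0 x1; have := le1 (1 - x).
  rewrite subr_gt0 gtrBl => /(_ x1 x0).
  by rewrite ler_norml; lra.
Qed.

Lemma powR_half_bound (v q : R) : 2^-1 <= v -> v <= 1 ->
  v `^ q <= 1 + 2^-1 `^ q.
Proof.
move=> v2 v1; have v0 : 0 < v by rewrite (lt_le_trans _ v2).
have h0 : 0 <= 2^-1 `^ q :> R := powR_ge0 _ _.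
have [q0|q0] := leP 0 q.
  have : v `^ q <= 1 `^ q by rewrite ge0_ler_powR// ?nnegrE ltW.
  by rewrite powR1; lra.
suff : v `^ q <= 2^-1 `^ q by lra.
rewrite -[q]opprK !(powRN _ (- q)) lef_pV2 ?posrE ?powR_gt0//.
by rewrite ge0_ler_powR ?nnegrE// ?oppr_ge0 ltW.
Qed.

(** On each half of the interval one of the two factors is bounded, which
separates the two singularities. *)
Lemma powR_onem_powR_le (q u : R) : u \in `]0, 1[ ->
  u `^ q * (1 - u) `^ q <= (1 + 2^-1 `^ q) * (u `^ q + (1 - u) `^ q).
Proof.
rewrite in_itv/= => /andP[u0 u1].
have C0 : 0 <= 1 + 2^-1 `^ q :> R by rewrite addr_ge0// powR_ge0.
have a0 : 0 <= u `^ q := powR_ge0 _ _.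
have b0 : 0 <= (1 - u) `^ q := powR_ge0 _ _.
rewrite mulrDr; have [u2|u2] := leP u 2^-1.
  rewrite mulrC (@le_trans _ _ ((1 + 2^-1 `^ q) * u `^ q))//.
    by rewrite ler_wpM2r// powR_half_bound//; lra.
  by rewrite lerDl mulr_ge0.
rewrite (@le_trans _ _ ((1 + 2^-1 `^ q) * (1 - u) `^ q))//.
  by rewrite ler_wpM2r// powR_half_bound//; lra.
by rewrite lerDr mulr_ge0.
Qed.

Lemma Gamma_ge0 (a : R) : 0 <= Gamma a.
Proof.
by apply: Rintegral_ge0 => x _; rewrite mulr_ge0 ?powR_ge0 ?expR_ge0.
Qed.

Lemma beta_constant_ge0 (s : R) : 0 <= Gamma (4 * s) / Gamma (2 * s) ^+ 2.
Proof. by rewrite mulr_ge0 ?invr_ge0 ?exprn_ge0 ?Gamma_ge0. Qed.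

Lemma beta_density_ge0 (s u : R) : 0 <= beta_density s u.
Proof.
apply: mulr_ge0; last exact: powR_ge0.
by apply: mulr_ge0; [exact: beta_constant_ge0|exact: powR_ge0].
Qed.

Lemma measurable_beta_density (s : R) : measurable_fun setT (beta_density s).
Proof.
rewrite /beta_density; apply: measurable_funM.
  by apply: measurable_funM => //; exact: measurable_powR.
by apply: (measurableT_comp (measurable_powR _)); exact: measurable_funB.
Qed.

Lemma integrable_beta_density (s : R) : 0 < s ->
  mu.-integrable `[0, 1] (EFin \o beta_density s).
Proof.
move=> s0; apply/integrableP; split.
  by apply/measurable_EFinP; apply: measurable_funTS; exact: measurable_beta_density.
under eq_integral do rewrite /= ger0_norm ?beta_density_ge0//.
have mb : measurable_fun (`]0, 1[%classic : set R) (fun u => (beta_density s u)%:E).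
  by apply/measurable_EFinP; apply: measurable_funTS; exact: measurable_beta_density.
rewrite integral_itv_bndoo//.
pose q := 2 * s - 1; pose C := Gamma (4 * s) / Gamma (2 * s) ^+ 2 * (1 + 2^-1 `^ q).
have C0 : 0 <= C by rewrite mulr_ge0 ?beta_constant_ge0// addr_ge0 ?powR_ge0.
have mp : measurable_fun (`]0, 1[%classic : set R)
    (fun u : R => (u `^ q + (1 - u) `^ q)%:E).
  apply/measurable_EFinP; apply: measurable_funTS; apply: measurable_funD => //.
  by apply: (measurableT_comp (measurable_powR _)); exact: measurable_funB.
apply: (@le_lt_trans _ _
  (\int[mu]_(u in `]0%R, 1%R[) (C%:E * (u `^ q + (1 - u) `^ q)%:E))%E).
  apply: ge0_le_integral => //.
  - by move=> u _; rewrite lee_fin beta_density_ge0.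
  - by apply: measurable_funeM.
  - move=> u u01; rewrite -EFinM lee_fin /beta_density -/q.
    rewrite -[leLHS]mulrA -[leRHS]mulrA ler_wpM2l ?beta_constant_ge0//.
    exact: powR_onem_powR_le.
rewrite ge0_integralZl//.
  by rewrite lte_mul_pinfty ?lee_fin// integral_powR_onem_powR_lty// mulr_gt0.
by move=> u _; rewrite lee_fin addr_ge0 ?powR_ge0.
Qed.

End beta_mass.

(** * The gKMP generator *)

Section gKMP.
Context (N : nat) (R : realType).
Implicit Types (x y z : 'Z_N) (u s B : R) (eta xi : config N R) (g : config N R -> R).
Local Notation mu := (@lebesgue_measure R).

Lemma exchange_homo x y u eta xi :
  (forall z, (eta z)%:num <= (xi z)%:num) ->
  forall z, (exchange x y u eta z)%:num <= (exchange x y u xi z)%:num.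
Proof.
move=> exi z; rewrite /exchange; case: ifP => _ /=.
  by rewrite ler_wpM2l// lerD.
by case: ifP => _ //=; rewrite ler_wpM2l// lerD.
Qed.

Lemma measurable_exchange x y eta :
  measurable_fun setT (fun u : R => exchange x y u eta).
Proof.
apply: (@measurability _ _ _ _ setT _ (@coordinate_sets N R)) =>
  [//|_ [_ [z _ [C mC <-]] <-]].
rewrite !setTI -[X in measurable X]setTI.
have mz : measurable_fun setT (fun u : R => (exchange x y u eta z)%:num).
  rewrite (_ : (fun u => _) =
      if z == x then fun u => `|u| * ((eta x)%:num + (eta y)%:num)
      else if z == y then fun u => `|1 - u| * ((eta x)%:num + (eta y)%:num)
      else cst (eta z)%:num); last first.
    by apply/funext => u; rewrite /exchange; case: ifP => //; case: ifP.
  case: ifP => _; first by apply: measurable_funM => //; exact: measurableT_comp.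
  case: ifP => _ //; apply: measurable_funM => //; apply: measurableT_comp => //.
  exact: measurable_funB.
exact: mz.
Qed.

Lemma integrable_beta_increment s g x y eta : 0 < s ->
  measurable_fun setT g -> bounded_fun g ->
  mu.-integrable `[0, 1]
    (EFin \o (fun u => beta_density s u * (g (exchange x y u eta) - g eta))).
Proof.
move=> s0 mg bg; have [M gM] := (bounded_funP g).1 bg.
pose k (u : measurableTypeR R) := g (exchange x y u eta) - g eta.
have mI : measurable (`[0, 1]%classic : set (measurableTypeR R)).
  exact: measurable_itv.
have := integrableMl mI (integrable_beta_density s0) (h := k).
move=> /(_ _ _)/wrap[||].
- apply: measurable_funTS; apply: measurable_funB => //.
  by apply: measurableT_comp => //; exact: measurable_exchange.
- exists (M + M); split; first exact: num_real.
  move=> K MK u _ /=; rewrite (le_trans _ (ltW MK))//.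
  by rewrite (le_trans (ler_normB _ _))//; exact: lerD.
- by apply: eq_integrable.
Qed.

(** With [d = g eta - g xi], the jump at [(x, u)] changes the defect from [d] to at
most [B], so the defect after an Euler step is at most [d + h c (B - d)], which
is below [B] when [h c <= 1].  The bound [1 / (c + 1)] on [h] also covers
[c = 0]. *)
Lemma gKMP_euler_step s : 0 < s ->
  exists2 a, 0 < a & forall h : R, 0 < h -> h < a -> forall g B,
    measurable_fun setT g -> bounded_fun g -> 0 <= B ->
    (forall eta xi, (forall z, (eta z)%:num <= (xi z)%:num) -> g eta - g xi <= B) ->
    forall eta xi, (forall z, (eta z)%:num <= (xi z)%:num) ->
      (g eta + h * gKMP_generator s g eta) -
      (g xi + h * gKMP_generator s g xi) <= B.
Proof.
move=> s0.
have mI : measurable (`[0, 1]%classic : set (measurableTypeR R)).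
  exact: measurable_itv.
pose m := \int[mu]_(u in `[0, 1]) beta_density s u.
have m0 : 0 <= m by apply: Rintegral_ge0 => u _; exact: beta_density_ge0.
pose c : R := \sum_(x : 'Z_N) m.
have c0 : 0 <= c by apply: sumr_ge0.
exists (c + 1)^-1 => [|h h0 hc g B mg bg B0 gB eta xi exi].
  by rewrite invr_gt0 ltr_wpDl.
have {}hc : h * c <= 1.
  have c1 : 0 < c + 1 by rewrite ltr_wpDl.
  have : h * (c + 1) < 1 by rewrite -ltr_pdivlMr// mul1r.
  by rewrite mulrDr; lra.
have DB := gB _ _ exi.
have Ls : gKMP_generator s g eta - gKMP_generator s g xi
    <= c * (B - (g eta - g xi)).
  rewrite /gKMP_generator -sumrB mulr_suml; apply: ler_sum => x _.
  rewrite -RintegralB//; [|exact: integrable_beta_increment..].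
  rewrite -RintegralZr//; last exact: integrable_beta_density.
  have Ib := integrable_beta_density s0.
  apply: le_Rintegral => //.
  - have := integrableB mI
      (integrable_beta_increment x (x + 1) eta s0 mg bg)
      (integrable_beta_increment x (x + 1) xi s0 mg bg).
    by apply: eq_integrable.
  - have := integrableZl mI (B - (g eta - g xi)) Ib.
    by apply: eq_integrable => // u _ /=; rewrite -EFinM mulrC.
  - move=> u _; rewrite -mulrBr ler_wpM2l ?beta_density_ge0//.
    by have := gB _ _ (exchange_homo x (x + 1) u exi); lra.
have : h * (gKMP_generator s g eta - gKMP_generator s g xi)
    <= h * c * (B - (g eta - g xi)) by rewrite -mulrA ler_pM2l.
have : h * c * (B - (g eta - g xi)) <= B - (g eta - g xi).
  by rewrite ler_piMl// subr_ge0.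
by rewrite mulrBr; lra.
Qed.

End gKMP.

Theorem theorem3p2 (R : realType) (N : nat) (hN : (1 < N)%N)
    (s : R) (hs : 0 < s) (S : R -> R.-pker (config N R) ~> (config N R))
    (hS : markov_semigroup S) (hL : has_generator S (@gKMP_generator N R s)) :
  attractive S.
Proof.
move=> mu1 mu2 mu12 t t0 f mf bf fle.
have Ef (mu : probability (config N R) R) :
    ('E_(law_at (S t) mu)[f] = 'E_mu[semigroup_op S t f])%E.
  have mu1T : mu setT = 1%E by exact: probability_setT.
  have law1T : law_at (S t) mu setT = 1%E by exact: probability_setT.
  have mSf := measurable_semigroup_op S t mf bf.
  have bSf := bounded_semigroup_op S t mf bf.
  rewrite unlock -[LHS]fineK; last first.
    exact: integrable_fin_num (bounded_integrable law1T mf bf).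
  rewrite -[RHS]fineK; last first.
    exact: integrable_fin_num (bounded_integrable mu1T mSf bSf).
  by congr EFin; exact: Rintegral_mixture.
rewrite !Ef; apply: mu12.
- exact: measurable_semigroup_op.
- exact: bounded_semigroup_op.
- move=> eta xi.
  apply: (semigroup_op_homo hS hL (gKMP_euler_step N hs)) => //.
Qed.
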